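(* Let $k$ be a field. The PROP $\mathtt{FinVect}_k$ is presented by the generators $s_c\colon 1\to 1$ (one for each $c\in k$), $\mu\colon 2\to 1$, $\zeta\colon 0\to 1$, $\Delta\colon 1\to 2$, $!\colon 1\to 0$ and the following equations (for all $b,c\in k$, with $1$ the identity on the object $1$, $1_0$ the identity on the object $0$, $B\colon 2\to2$ the braiding, and $\oplus$ the tensor product of morphisms): (1) $\mu\circ(\zeta\oplus 1)=1$; (2) $\mu\circ(1\oplus\mu)=\mu\circ(\mu\oplus 1)$; (3) $\mu\circ B=\mu$; (4) $(!\oplus 1)\circ\Delta=1$; (5) $(1\oplus\Delta)\circ\Delta=(\Delta\oplus 1)\circ\Delta$; (6) $B\circ\Delta=\Delta$; (7) $\Delta\circ\mu=(\mu\oplus\mu)\circ(1\oplus B\oplus 1)\circ(\Delta\oplus\Delta)$; (8) $\Delta\circ\zeta=\zeta\oplus\zeta$; (9) $!\circ\mu={!}\oplus{!}$; (10) $!\circ\zeta=1_0$; (11) $s_{bc}=s_b\circ s_c$; (12) $s_{b+c}=\mu\circ(s_b\oplus s_c)\circ\Delta$; (13) $s_1=1$; (14) $s_0=\zeta\circ{!}$; (15) $\mu\circ(s_c\oplus s_c)=s_c\circ\mu$; (16) $s_c\circ\zeta=\zeta$; (17) $(s_c\oplus s_c)\circ\Delta=\Delta\circ s_c$; (18) $!\circ s_c={!}$. That is, the PROP morphism from the free PROP on these generators to $\mathtt{FinVect}_k$ which interprets $s_c$ as $x\mapsto cx$, $\mu$ as $(x,y)\mapsto x+y$, $\zeta$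 as the unique linear map $\{0\}\to k$, $\Delta$ as $x\mapsto(x,x)$ and $!$ as the unique linear map $k\to\{0\}$, exhibits $\mathtt{FinVect}_k$ as the PROP presented by these generators and equations.
   Context: A PROP is a strict symmetric monoidal category whose objects are the natural numbers, with monoidal product of objects given by addition. A PROP morphism is a strict symmetric monoidal functor sending the object $1$ to the object $1$. $\mathtt{FinVect}_k$ is the PROP whose morphisms $m\to n$ are the linear maps $k^m\to k^n$, with the usual composition and with direct sum as tensor product. A signature $\Sigma$ is a set of formal symbols $\sigma\colon m\to n$ ($m,n\in\mathbb N$). $\Sigma$-terms are built inductively from $\mathrm{id}\colon1\to1$, the braiding $2\to 2$ and the symbols of $\Sigma$ by composition and monoidal product; an equation is a pair of $\Sigma$-terms of the same type. $\mathtt F\Sigma$ is the free PROP on $\Sigma$. Given a set $E$ of equations, let $\mathcal E$ be the signature with one symbol for each equation in $E$, of the same type, and let $\lambda,\rho\colon\mathtt F\mathcal E\to\mathtt F\Sigma$ be the PROP morphisms sending each such symbol to the left-hand, respectively right-hand, side of the equation. The PROP presented by $(\Sigma,E)$ is the coequalizer of $\lambda,\rho$ in the category of PROPs. $g\circ f$ means first $f$, then $g$. *)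

(* Defs.v *)
From HB Require Import structures.
From mathcomp Require Import all_boot all_order all_algebra.
From mathcomp Require Import boolp.

Set Implicit Arguments.
Unset Strict Implicit.
Unset Printing Implicit Defensive.

Import GRing.Theory.
Local Open Scope quotient_scope.

Declare Scope prop_scope.
Delimit Scope prop_scope with PR.
Declare Scope sterm_scope.
Delimit Scope sterm_scope with ST.
Reserved Notation "g ∘ f" (at level 40, left associativity).
Reserved Notation "f ⊕ g" (at level 50, left associativity).

(* Transport of a morphism along equalities of its source and target: strict
   associativity and unitality hold only up to propositional equalities of
   natural numbers. *)
Definition hcast (H : nat -> nat -> Type) m m' n n'
    (em : m = m') (en : n = n') (f : H m n) : H m' n' :=
  ecast i (H i n') em (ecast j (H m j) en f).

Arguments hcast : simpl never.

Lemma hcast_id (H : nat -> nat -> Type) m n (em : m = m) (en : n = n)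
  (f : H m n) : hcast em en f = f.
Proof. by rewrite (eq_irrelevance em erefl) (eq_irrelevance en erefl). Qed.

Lemma hcast_trans (H : nat -> nat -> Type) m m' m'' n n' n''
   (e1 : m = m') (e2 : n = n') (e3 : m' = m'') (e4 : n' = n'') (f : H m n) :
  hcast e3 e4 (hcast e1 e2 f) = hcast (etrans e1 e3) (etrans e2 e4) f.
Proof. by case: m'' / e3; case: n'' / e4; case: m' / e1; case: n' / e2. Qed.

Lemma hcast_irr (H : nat -> nat -> Type) m m' n n'
   (e1 e1' : m = m') (e2 e2' : n = n') (f : H m n) :
  hcast e1 e2 f = hcast e1' e2' f.
Proof. by rewrite (eq_irrelevance e1 e1') (eq_irrelevance e2 e2'). Qed.

Record prop_ops : Type := PropOps {
  hom :> nat -> nat -> Type;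
  idm : forall n, hom n n;
  comp : forall m n l, hom n l -> hom m n -> hom m l;
  tens : forall m n m' n', hom m n -> hom m' n' -> hom (m + m') (n + n');
  braid : forall m n, hom (m + n) (n + m) }.

Arguments idm {p} n : rename.
Arguments comp {p m n l} _ _.
Arguments tens {p m n m' n'} _ _.
Arguments braid {p} m n.

Notation "g ∘ f" := (comp g%PR f%PR) : prop_scope.
Notation "f ⊕ g" := (tens f%PR g%PR) : prop_scope.

(* The axioms of a strict symmetric monoidal category with objects nat and
   with addition as tensor product of objects, up to a family R of relations:
   R is equality for PROPs themselves, and the congruence to be generated in
   the construction of free PROPs. *)
Record prop_axioms (P : prop_ops) (R : forall m n, P m n -> P m n -> Prop)
    : Prop := PropAxioms {
  ax_compA : forall m n p q (h : P p q) (g : P n p) (f : P m n),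
    R _ _ (h ∘ (g ∘ f))%PR ((h ∘ g) ∘ f)%PR;
  ax_comp1m : forall m n (f : P m n), R _ _ (idm n ∘ f)%PR f;
  ax_compm1 : forall m n (f : P m n), R _ _ (f ∘ idm m)%PR f;
  ax_tens_id : forall m n, R _ _ (idm m ⊕ idm n)%PR (idm (m + n));
  ax_tens_comp : forall m n p m' n' p'
      (g : P n p) (f : P m n) (g' : P n' p') (f' : P m' n'),
    R _ _ ((g ∘ f) ⊕ (g' ∘ f'))%PR ((g ⊕ g') ∘ (f ⊕ f'))%PR;
  ax_tensA : forall m n m' n' m'' n'' (f : P m n) (g : P m' n') (h : P m'' n''),
    R _ _ (hcast (addnA m m' m'') (addnA n n' n'') (f ⊕ (g ⊕ h))%PR)
          ((f ⊕ g) ⊕ h)%PR;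
  ax_tens0m : forall m n (f : P m n), R _ _ (idm 0 ⊕ f)%PR f;
  ax_tensm0 : forall m n (f : P m n),
    R _ _ (hcast (addn0 m) (addn0 n) (f ⊕ idm 0)%PR) f;
  ax_braid_nat : forall m n p q (f : P m n) (g : P p q),
    R _ _ (braid n q ∘ (f ⊕ g))%PR ((g ⊕ f) ∘ braid m p)%PR;
  ax_braidK : forall m n, R _ _ (braid n m ∘ braid m n)%PR (idm (m + n));
  ax_braidm0 : forall m, R _ _ (hcast (addn0 m) erefl (braid m 0)) (idm m);
  ax_hexagon : forall m n p,
    R _ _ (hcast (addnA m n p) erefl (braid m (n + p)))
          (hcast (addnA n m p) (addnA n p m) (idm n ⊕ braid m p)
           ∘ (braid m n ⊕ idm p))%PR }.

Record PROP : Type := MkPROP {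
  ops :> prop_ops;
  propP : prop_axioms (fun m n => @eq (ops m n)) }.

Section PROPTheory.
Variable P : PROP.
Let A := propP P.

Lemma hcast_comp m m' n n' p p' (em : m = m') (en : n = n') (ep : p = p')
    (g : P n p) (f : P m n) :
  hcast em ep (g ∘ f)%PR = (hcast en ep g ∘ hcast em en f)%PR.
Proof. by case: m' / em; case: n' / en; case: p' / ep. Qed.

Lemma hcast_idm m m' (e1 e2 : m = m') : hcast e1 e2 (idm m) = idm m' :> P _ _.
Proof. by case: m' / e1 e2 => e2; rewrite hcast_id. Qed.

Lemma braid0m n : hcast erefl (addn0 n) (braid 0 n) = idm n :> P _ _.
Proof.
have K := ax_braidK A 0 n.
rewrite -[LHS](ax_comp1m A) -(ax_braidm0 A n).
rewrite -(hcast_comp erefl (addn0 n) erefl) K.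
exact: esym (ax_braidm0 A n).
Qed.

Lemma braidSm m n : braid (1 + m) n =
  hcast erefl (esym (addnA n 1 m)) ((braid 1 n ⊕ idm m) ∘ (idm 1 ⊕ braid m n))%PR
  :> P _ _.
Proof.
set X : P (1 + m + n) (n + 1 + m) :=
  ((braid 1 n ⊕ idm m) ∘ (idm 1 ⊕ braid m n))%PR.
have KX : (X ∘ hcast (addnA n 1 m) erefl (braid n (1 + m)))%PR = idm _.
  rewrite (ax_hexagon A n 1 m) hcast_id /X.
  set a := tens _ (idm m); set b := tens (idm 1) _.
  set c := tens _ _; set d := tens _ (idm m).
  have bc : (b ∘ c)%PR = idm _ :> P (1 + (n + m)) (1 + (n + m)).
    by rewrite -(ax_tens_comp A) (ax_comp1m A) (ax_braidK A) (ax_tens_id A).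
  have ad : (a ∘ d)%PR = idm _.
    by rewrite -(ax_tens_comp A) (ax_comp1m A) (ax_braidK A) (ax_tens_id A).
  rewrite -[RHS]ad -[d in RHS](ax_comp1m A) -[idm _ in RHS]bc.
  exact: etrans (esym (ax_compA A _ _ _)) (congr1 _ (ax_compA A _ _ _)).
have K := ax_braidK A (1 + m) n.
rewrite -[RHS](ax_compm1 A) -K (ax_compA A).
rewrite -[LHS](ax_comp1m A); congr (_ ∘ _)%PR.
rewrite -[braid n (1 + m)](hcast_id erefl erefl).
have -> : hcast erefl erefl (braid n (1 + m)) =
   hcast (esym (addnA n 1 m)) erefl (hcast (addnA n 1 m) erefl (braid n (1 + m)))
   :> P _ _.
  by rewrite hcast_trans; apply: hcast_irr.
by rewrite -hcast_comp KX hcast_idm.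
Qed.

End PROPTheory.

(* A strict monoidal functor fixing the object 1 is the identity on objects,
   so that a PROP morphism is determined by its action on morphisms. *)
Record PROP_mor (P Q : PROP) : Type := MkPROPMor {
  mor :> forall m n, P m n -> Q m n;
  mor_id : forall n, mor (idm n) = idm n;
  mor_comp : forall m n p (g : P n p) (f : P m n),
    mor (g ∘ f)%PR = (mor g ∘ mor f)%PR;
  mor_tens : forall m n p q (f : P m n) (g : P p q),
    mor (f ⊕ g)%PR = (mor f ⊕ mor g)%PR;
  mor_braid : forall m n, mor (braid m n) = braid m n }.

Arguments mor {P Q} p {m n} _ : rename.

Lemma PROP_mor_ext (P Q : PROP) (F G : PROP_mor P Q) :
  (forall m n (f : P m n), F m n f = G m n f) -> F = G.
Proof.
case: F => F F1 F2 F3 F4; case: G => G G1 G2 G3 G4 /= FG.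
have {}FG : F = G.
  by apply: functional_extensionality_dep => m;
     apply: functional_extensionality_dep => n; apply: funext => f; exact: FG.
by case: G / FG G1 G2 G3 G4 => G1 G2 G3 G4; congr MkPROPMor; exact: Prop_irrelevance.
Qed.

Program Definition mor_compose (P Q S : PROP) (G : PROP_mor Q S)
    (F : PROP_mor P Q) : PROP_mor P S :=
  @MkPROPMor P S (fun m n f => G m n (F m n f)) _ _ _ _.
Next Obligation. by rewrite !mor_id. Qed.
Next Obligation. by rewrite !mor_comp. Qed.
Next Obligation. by rewrite !mor_tens. Qed.
Next Obligation. by rewrite !mor_braid. Qed.

Definition is_coequalizer (A B C : PROP) (f g : PROP_mor A B)
    (q : PROP_mor B C) : Prop :=
  mor_compose q f = mor_compose q g /\
  forall (P : PROP) (G : PROP_mor B P), mor_compose G f = mor_compose G g ->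
    exists! H : PROP_mor C P, mor_compose H q = G.

(* S m n is the set of formal symbols of type m -> n. *)
Definition signature : Type := nat -> nat -> Type.

(* Besides the identity on 1, the identity on 0 is needed as a nullary tensor
   product: without it the unit of the monoidal product is not a term. *)
Inductive term (S : signature) : nat -> nat -> Type :=
| TId0 : term S 0 0
| TId1 : term S 1 1
| TBraid : term S 2 2
| TGen : forall m n, S m n -> term S m n
| TComp : forall m n p, term S n p -> term S m n -> term S m p
| TTens : forall m n p q,
    term S m n -> term S p q -> term S (m + p) (n + q).

Arguments TId0 {S}.
Arguments TId1 {S}.
Arguments TBraid {S}.
Arguments TGen {S m n} _.

Bind Scope sterm_scope with term.
Notation "g ∘ f" := (TComp g f) : sterm_scope.
Notation "f ⊕ g" := (TTens f g) : sterm_scope.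

Section FreePROP.
Variable S : signature.

Fixpoint term_id n : term S n n :=
  if n is n'.+1 then TTens TId1 (term_id n') else TId0.

(* The braiding of 1 with n, and then the braiding of m with n, as composites
   of elementary braidings. *)
Fixpoint term_braid1 n : term S (1 + n) (n + 1) :=
  if n is n'.+1 then
    TComp (TTens TId1 (term_braid1 n')) (TTens TBraid (term_id n'))
  else TId1.

Fixpoint term_braid m n : term S (m + n) (n + m) :=
  if m is m'.+1 then
    hcast erefl (esym (addnA n 1 m'))
      (TComp (TTens (term_braid1 n) (term_id m')) (TTens TId1 (term_braid m' n)))
  else hcast erefl (esym (addn0 n)) (term_id n).

Definition term_ops : prop_ops :=
  PropOps term_id (@TComp S) (@TTens S) term_braid.

Record congruence (R : forall m n, term S m n -> term S m n -> Prop) : Prop :=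
  Congruence {
  cong_refl : forall m n (t : term S m n), R m n t t;
  cong_sym : forall m n (t u : term S m n), R m n t u -> R m n u t;
  cong_trans : forall m n (t u v : term S m n),
    R m n t u -> R m n u v -> R m n t v;
  cong_comp : forall m n p (t t' : term S n p) (u u' : term S m n),
    R n p t t' -> R m n u u' -> R m p (TComp t u) (TComp t' u');
  cong_tens : forall m n p q (t t' : term S m n) (u u' : term S p q),
    R m n t t' -> R p q u u' -> R _ _ (TTens t u) (TTens t' u') }.

(* The least congruence on terms satisfying the axioms of PROPs. *)
Definition term_equiv m n (t u : term S m n) : Prop :=
  forall R, congruence R -> prop_axioms (P := term_ops) R -> R m n t u.

Lemma term_equiv_congruence : congruence term_equiv.
Proof.
split.
- by move=> m n t R cR aR; apply: cong_refl.
- by move=> m n t u tu R cR aR; apply: cong_sym => //; apply: tu.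
- move=> m n t u v tu uv R cR aR.
  by apply: (cong_trans cR (u := u)); [apply: tu | apply: uv].
- by move=> m n p t t' u u' tt uu R cR aR; apply: cong_comp; [|apply: tt|apply: uu].
- by move=> m n p q t t' u u' tt uu R cR aR; apply: cong_tens; [|apply: tt|apply: uu].
Qed.

Lemma term_equiv_axioms : prop_axioms (P := term_ops) term_equiv.
Proof. by split=> *; move=> R cR []. Qed.

Definition term_rel m n : rel {classic (term S m n)} :=
  fun t u => `[< term_equiv (t : term S m n) (u : term S m n) >].

Lemma term_rel_refl m n : reflexive (@term_rel m n).
Proof. by move=> t; apply/asboolP; apply: cong_refl term_equiv_congruence _ _ _. Qed.

Lemma term_rel_sym m n : symmetric (@term_rel m n).
Proof.
by move=> t u; apply/idP/idP => /asboolP tu; apply/asboolP;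
  apply: cong_sym term_equiv_congruence _ _ _ _ tu.
Qed.

Lemma term_rel_trans m n : transitive (@term_rel m n).
Proof.
move=> u t v /asboolP tu /asboolP uv; apply/asboolP.
exact: cong_trans term_equiv_congruence _ _ _ _ _ tu uv.
Qed.

Canonical term_equiv_rel m n :=
  EquivRel (@term_rel m n) (@term_rel_refl m n) (@term_rel_sym m n)
    (@term_rel_trans m n).

Definition free_hom m n : Type := {eq_quot (term_equiv_rel m n)}.

Definition tclass m n (t : term S m n) : free_hom m n :=
  \pi_{eq_quot (term_equiv_rel m n)} (t : {classic (term S m n)}).

Definition trepr m n (a : free_hom m n) : term S m n :=
  repr (a : {eq_quot (term_equiv_rel m n)}).

Lemma tclassP m n (t u : term S m n) :
  tclass t = tclass u <-> term_equiv t u.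
Proof.
split=> [/eqmodP/asboolP // | tu]; apply/eqmodP; exact/asboolP.
Qed.

Lemma treprK m n (a : free_hom m n) : tclass (trepr a) = a.
Proof. exact: reprK. Qed.

Lemma trepr_class m n (t : term S m n) : term_equiv (trepr (tclass t)) t.
Proof. by apply/tclassP; rewrite treprK. Qed.

Definition free_comp m n p (g : free_hom n p) (f : free_hom m n) :
  free_hom m p := tclass (TComp (trepr g) (trepr f)).

Definition free_tens m n p q (f : free_hom m n) (g : free_hom p q) :
  free_hom (m + p) (n + q) := tclass (TTens (trepr f) (trepr g)).

Definition free_ops : prop_ops :=
  @PropOps free_hom (fun n => tclass (term_id n)) free_comp free_tens
    (fun m n => tclass (term_braid m n)).

Lemma tclass_comp m n p (t : term S n p) (u : term S m n) :
  tclass (TComp t u) = free_comp (tclass t) (tclass u).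
Proof.
apply/tclassP; apply: cong_comp term_equiv_congruence _ _ _ _ _ _ _ _ _;
  apply: cong_sym term_equiv_congruence _ _ _ _ _; exact: trepr_class.
Qed.

Lemma tclass_tens m n p q (t : term S m n) (u : term S p q) :
  tclass (TTens t u) = free_tens (tclass t) (tclass u).
Proof.
apply/tclassP; apply: cong_tens term_equiv_congruence _ _ _ _ _ _ _ _ _ _;
  apply: cong_sym term_equiv_congruence _ _ _ _ _; exact: trepr_class.
Qed.

Lemma tclass_cast m m' n n' (em : m = m') (en : n = n') (t : term S m n) :
  tclass (hcast em en t) = hcast (H := free_hom) em en (tclass t).
Proof. by case: m' / em; case: n' / en. Qed.

Lemma free_axioms : prop_axioms (fun m n => @eq (free_ops m n)).
Proof.
have E := @tclassP; have A := term_equiv_axioms.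
split => /=.
- move=> m n p q h g f; rewrite -[h]treprK -[g]treprK -[f]treprK.
  rewrite -(tclass_comp (trepr g)) -(tclass_comp (trepr h)) -!tclass_comp.
  by apply/E; apply: (ax_compA A).
- move=> m n f; rewrite -[f]treprK -!tclass_comp.
  by apply/E; apply: (ax_comp1m A).
- move=> m n f; rewrite -[f]treprK -!tclass_comp.
  by apply/E; apply: (ax_compm1 A).
- by move=> m n; rewrite -tclass_tens; apply/E; apply: (ax_tens_id A).
- move=> m n p m' n' p' g f g' f'.
  rewrite -[g]treprK -[f]treprK -[g']treprK -[f']treprK.
  rewrite -(tclass_comp (trepr g) (trepr f)) -(tclass_comp (trepr g') (trepr f')).
  rewrite -(tclass_tens (trepr g) (trepr g')) -(tclass_tens (trepr f) (trepr f')).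
  rewrite -tclass_tens -tclass_comp.
  by apply/E; apply: (ax_tens_comp A).
- move=> m n m' n' m'' n'' f g h.
  rewrite -[h]treprK -[g]treprK -[f]treprK.
  rewrite -(tclass_tens (trepr g)) -(tclass_tens (trepr f) (trepr g)) -!tclass_tens.
  by rewrite -tclass_cast; apply/E; apply: (ax_tensA A).
- move=> m n f; rewrite -[f]treprK -tclass_tens.
  by apply/E; apply: (ax_tens0m A).
- move=> m n f; rewrite -[f]treprK -tclass_tens -tclass_cast.
  by apply/E; apply: (ax_tensm0 A).
- move=> m n p q f g; rewrite -[f]treprK -[g]treprK.
  rewrite -(tclass_tens (trepr f)) -(tclass_tens (trepr g)) -!tclass_comp.
  by apply/E; apply: (ax_braid_nat A).
- by move=> m n; rewrite -tclass_comp; apply/E; apply: (ax_braidK A).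
- by move=> m; rewrite -tclass_cast; apply/E; apply: (ax_braidm0 A).
- move=> m n p; rewrite -(tclass_tens (term_id n)) -(tclass_tens (term_braid m n)).
  rewrite -!tclass_cast -tclass_comp.
  by apply/E; apply: (ax_hexagon A).
Qed.

(* Its universal property is given by free_ext_gen and free_ext_unique below. *)
Definition freePROP : PROP := MkPROP free_axioms.

End FreePROP.

Arguments tclass {S m n} t.

Section Eval.
Variables (S : signature) (P : PROP) (phi : forall m n, S m n -> P m n).

Fixpoint eval m n (t : term S m n) : P m n :=
  match t in term _ m n return P m n with
  | TId0 => idm 0
  | TId1 => idm 1
  | TBraid => braid 1 1
  | TGen _ _ x => phi x
  | TComp _ _ _ g f => (eval g ∘ eval f)%PR
  | TTens _ _ _ _ f g => (eval f ⊕ eval g)%PR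
  end.

Let A := propP P.

Lemma eval_cast m m' n n' (em : m = m') (en : n = n') (t : term S m n) :
  eval (hcast em en t) = hcast em en (eval t).
Proof. by case: m' / em; case: n' / en. Qed.

Lemma eval_id n : eval (term_id S n) = idm n.
Proof. by elim: n => //= n ->; rewrite (ax_tens_id A). Qed.

Lemma eval_braid1 n : eval (term_braid1 S n) = braid 1 n.
Proof.
elim: n => [|n IHn] /=.
  by rewrite -(ax_braidm0 A 1) hcast_id.
rewrite IHn eval_id; have := ax_hexagon A 1 1 n.
by rewrite !hcast_id => ->.
Qed.

Lemma eval_braid m n : eval (term_braid S m n) = braid m n.
Proof.
elim: m n => [|m IHm] n /=.
  rewrite eval_cast eval_id -braid0m hcast_trans; exact: hcast_id.
by rewrite eval_cast /= eval_braid1 eval_id IHm [RHS]braidSm.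
Qed.

Lemma eval_sound m n (t u : term S m n) : term_equiv t u -> eval t = eval u.
Proof.
move/(_ (fun m n t u => eval t = eval u)); apply.
  split=> //=.
  - by move=> m' n' t1 t2 t3 -> ->.
  - by move=> m' n' p t1 t2 u1 u2 -> ->.
  - by move=> m' n' p q t1 t2 u1 u2 -> ->.
split=> /=.
- by move=> m' n' p q h g f; apply: (ax_compA A).
- by move=> m' n' f; rewrite eval_id; apply: (ax_comp1m A).
- by move=> m' n' f; rewrite eval_id; apply: (ax_compm1 A).
- by move=> m' n'; rewrite !eval_id; apply: (ax_tens_id A).
- by move=> m1 n1 p1 m2 n2 p2 g f g' f'; apply: (ax_tens_comp A).
- by move=> m1 n1 m2 n2 m3 n3 f g h; rewrite eval_cast; apply: (ax_tensA A).
- by move=> m' n' f; apply: (ax_tens0m A).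
- by move=> m' n' f; rewrite eval_cast; apply: (ax_tensm0 A).
- move=> m' n' p q f g; rewrite !eval_braid; exact: (ax_braid_nat A).
- move=> m' n'; rewrite !eval_braid eval_id; exact: (ax_braidK A).
- move=> m'; rewrite eval_cast eval_braid eval_id; exact: (ax_braidm0 A).
- move=> m' n' p; rewrite !eval_cast /= ?eval_cast /= !eval_braid !eval_id.
  exact: (ax_hexagon A).
Qed.

Definition free_ext_fun m n (a : freePROP S m n) : P m n := eval (trepr a).

Lemma free_ext_fun_class m n (t : term S m n) :
  free_ext_fun (tclass t) = eval t.
Proof. by apply: eval_sound; apply: trepr_class. Qed.

Program Definition free_ext : PROP_mor (freePROP S) P :=
  @MkPROPMor (freePROP S) P free_ext_fun _ _ _ _.
Next Obligation. by rewrite [LHS]free_ext_fun_class eval_id. Qed.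
Next Obligation. by rewrite [LHS]free_ext_fun_class. Qed.
Next Obligation. by rewrite [LHS]free_ext_fun_class. Qed.
Next Obligation. by rewrite [LHS]free_ext_fun_class eval_braid. Qed.

Lemma free_extE m n (t : term S m n) : free_ext m n (tclass t) = eval t.
Proof. exact: free_ext_fun_class. Qed.

Lemma free_ext_gen m n (x : S m n) : free_ext m n (tclass (TGen x)) = phi x.
Proof. exact: free_extE. Qed.

Lemma free_ext_unique (F : PROP_mor (freePROP S) P) :
  (forall m n (x : S m n), F m n (tclass (TGen x)) = phi x) -> F = free_ext.
Proof.
move=> FE; apply: PROP_mor_ext => m n f; rewrite -[f]treprK free_extE.
have B := term_equiv_axioms S.
elim: (trepr f) => {m n f} /=.
- by rewrite -(mor_id F).
- rewrite -(mor_id F); congr (F _ _ _); apply/tclassP.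
  move=> R cR aR; have := ax_tensm0 aR (TId1 : term_ops S 1 1).
  by rewrite hcast_id => h; apply: cong_sym.
- rewrite -(mor_braid F); congr (F _ _ _); apply: esym; apply/tclassP.
  move=> R cR aR /=; rewrite !hcast_id.
  have E1 : R 1 1 (TTens TId1 TId0) TId1.
    by have := ax_tensm0 aR (TId1 : term_ops S 1 1); rewrite hcast_id.
  have E2 : R 2 2 (TTens TId1 TId1) (TTens TId1 (TTens TId1 TId0)).
    by apply: cong_tens => //; [exact: cong_refl | exact: cong_sym].
  have E2l (t : term S 2 2) : R 2 2 (TComp (TTens TId1 TId1) t) t.
    apply: (cong_trans cR (u := TComp (TTens TId1 (TTens TId1 TId0)) t)).
      by apply: cong_comp => //; exact: cong_refl.
    exact: (ax_comp1m aR (t : term_ops S 2 2)).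
  have E2r (t : term S 2 2) :
      R 2 2 (TComp t (TTens TId1 (TTens TId1 TId0))) t.
    exact: (ax_compm1 aR (t : term_ops S 2 2)).
  have Em0 (t : term S 2 2) : R 2 2 (TTens t TId0) t.
    by have := ax_tensm0 aR (t : term_ops S 2 2); rewrite hcast_id.
  apply: (cong_trans cR (E2r _)).
  apply: (cong_trans cR (Em0 _)).
  apply: (cong_trans cR (E2l _)).
  exact: Em0.
- by move=> m n x; rewrite FE.
- by move=> m n p g Eg f Ef; rewrite tclass_comp -Eg -Ef -mor_comp.
- by move=> m n p q f Ef g Eg; rewrite tclass_tens -Eg -Ef -mor_tens.
Qed.

End Eval.

(* A set of equations: a set of pairs of terms of the same type. *)
Definition equations (S : signature) : Type :=
  forall m n, term S m n -> term S m n -> Prop.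

Section Presentation.
Variables (S : signature) (E : equations S).

Definition eq_signature : signature :=
  fun m n => {e : term S m n * term S m n | E e.1 e.2}.

Definition lhs_mor : PROP_mor (freePROP eq_signature) (freePROP S) :=
  @free_ext eq_signature (freePROP S) (fun m n e => tclass (sval e).1).

Definition rhs_mor : PROP_mor (freePROP eq_signature) (freePROP S) :=
  @free_ext eq_signature (freePROP S) (fun m n e => tclass (sval e).2).

Definition presented_by (C : PROP) (q : PROP_mor (freePROP S) C) : Prop :=
  is_coequalizer lhs_mor rhs_mor q.

End Presentation.

Section FinVect.
Local Open Scope ring_scope.
Variable k : fieldType.

Section DirectSum.
Variables m n p q : nat.
Variables (f : 'Hom('rV[k]_m, 'rV[k]_n)) (g : 'Hom('rV[k]_p, 'rV[k]_q)).

Definition dsum_fun (v : 'rV[k]_(m + p)) : 'rV[k]_(n + q) :=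
  row_mx (f (lsubmx v)) (g (rsubmx v)).

Lemma dsum_fun_linear : linear dsum_fun.
Proof.
move=> a u v; rewrite /dsum_fun !linearP scale_row_mx add_row_mx //.
Qed.

HB.instance Definition _ :=
  GRing.isLinear.Build k 'rV[k]_(m + p) 'rV[k]_(n + q) *:%R dsum_fun
    dsum_fun_linear.

Definition dsum : 'Hom('rV[k]_(m + p), 'rV[k]_(n + q)) := linfun dsum_fun.

Lemma dsumE u v : dsum (row_mx u v) = row_mx (f u) (g v).
Proof. by rewrite lfunE /= /dsum_fun row_mxKl row_mxKr. Qed.
End DirectSum.

Section Swap.
Variables m n : nat.

Definition swap_fun (v : 'rV[k]_(m + n)) : 'rV[k]_(n + m) :=
  row_mx (rsubmx v) (lsubmx v).

Lemma swap_fun_linear : linear swap_fun.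
Proof. by move=> a u v; rewrite /swap_fun !linearP scale_row_mx add_row_mx. Qed.

HB.instance Definition _ :=
  GRing.isLinear.Build k 'rV[k]_(m + n) 'rV[k]_(n + m) *:%R swap_fun
    swap_fun_linear.

Definition swap : 'Hom('rV[k]_(m + n), 'rV[k]_(n + m)) := linfun swap_fun.

Lemma swapE u v : swap (row_mx u v) = row_mx v u.
Proof. by rewrite lfunE /= /swap_fun row_mxKl row_mxKr. Qed.
End Swap.

Definition FinVect_ops : prop_ops :=
  @PropOps (fun m n => 'Hom('rV[k]_m, 'rV[k]_n))
    (fun n => \1%VF) (fun m n p g f => (g \o f)%VF) dsum swap.

Lemma FinVect_cast m m' n n' (em : m = m') (en : n = n')
    (f : 'Hom('rV[k]_m, 'rV[k]_n)) v :
  hcast (H := FinVect_ops) em en f v =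
  castmx (erefl, en) (f (castmx (erefl, esym em) v)).
Proof. by case: m' / em v => v; case: n' / en; rewrite !castmx_id. Qed.

Lemma rV0_eq (u v : 'rV[k]_0) : u = v.
Proof. by apply/rowP => -[]. Qed.

Lemma row0_mx n (u : 'rV[k]_0) (v : 'rV[k]_n) : row_mx u v = v.
Proof. by rewrite (rV0_eq u 0) row_thin_mx. Qed.

Lemma row_mx0_cast n (e : (n + 0)%N = n) (v : 'rV[k]_n) (u : 'rV[k]_0) :
  castmx (erefl, e) (row_mx v u) = v.
Proof.
apply/rowP => i; rewrite castmxE /= cast_ord_id.
have -> : cast_ord (esym e) i = lshift 0 i by apply: val_inj.
by rewrite row_mxEl.
Qed.

Lemma row_mxA_cast m n p (e : (m + n + p)%N = (m + (n + p))%N)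
    (u : 'rV[k]_m) (v : 'rV[k]_n) (w : 'rV[k]_p) :
  castmx (erefl, e) (row_mx (row_mx u v) w) = row_mx u (row_mx v w).
Proof. by rewrite (eq_irrelevance e (esym (addnA m n p))) row_mxA. Qed.

Lemma row_mxA_castV m n p (e : (m + (n + p))%N = (m + n + p)%N)
    (u : 'rV[k]_m) (v : 'rV[k]_n) (w : 'rV[k]_p) :
  castmx (erefl, e) (row_mx u (row_mx v w)) = row_mx (row_mx u v) w.
Proof.
by rewrite -(row_mxA_cast (esym e)) castmx_comp /= castmx_id.
Qed.

Lemma FinVect_axioms : prop_axioms (fun m n => @eq (FinVect_ops m n)).
Proof.
split => /=.
- by move=> *; apply/lfunP => v; rewrite !comp_lfunE.
- by move=> *; apply/lfunP => v; rewrite !(comp_lfunE, id_lfunE).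
- by move=> *; apply/lfunP => v; rewrite !(comp_lfunE, id_lfunE).
- move=> m n; apply/lfunP => v.
  by rewrite -[v]hsubmxK dsumE !id_lfunE.
- move=> m n p m' n' p' g f g' f'; apply/lfunP => v.
  by rewrite -[v]hsubmxK comp_lfunE !dsumE !comp_lfunE.
- move=> m n m' n' m'' n'' f g h; apply/lfunP => v.
  rewrite FinVect_cast -[v]hsubmxK -[lsubmx v]hsubmxK row_mxA_cast.
  by rewrite !dsumE row_mxA_castV.
- move=> m n f; apply/lfunP => v.
  by rewrite -[v in LHS](row0_mx 0) dsumE row0_mx.
- move=> m n f; apply/lfunP => v; rewrite FinVect_cast.
  rewrite -{1}(row_mx0_cast (addn0 m) v 0) castmx_comp castmx_id.
  by rewrite dsumE row_mx0_cast.
- move=> m n p q f g; apply/lfunP => v.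
  by rewrite -[v]hsubmxK !comp_lfunE dsumE !swapE dsumE.
- move=> m n; apply/lfunP => v.
  by rewrite -[v]hsubmxK comp_lfunE !swapE id_lfunE.
- move=> m; apply/lfunP => v; rewrite FinVect_cast castmx_id id_lfunE.
  rewrite -{1}(row_mx0_cast (addn0 m) v 0) castmx_comp castmx_id.
  by rewrite swapE row0_mx.
- move=> m n p; apply/lfunP => v; rewrite FinVect_cast castmx_id.
  rewrite -[v]hsubmxK -[lsubmx v]hsubmxK row_mxA_cast swapE.
  rewrite comp_lfunE dsumE swapE id_lfunE.
  by rewrite FinVect_cast row_mxA_cast dsumE swapE id_lfunE row_mxA_castV.
Qed.

Definition FinVect : PROP := MkPROP FinVect_axioms.

Inductive FV_sig : signature :=
| Scal : k -> FV_sig 1%N 1%N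
| Mu : FV_sig 2%N 1%N
| Zeta : FV_sig 0%N 1%N
| Delta : FV_sig 1%N 2%N
| Bang : FV_sig 1%N 0%N.

Definition add_fun (v : 'rV[k]_(1 + 1)) : 'rV[k]_1 := lsubmx v + rsubmx v.

Lemma add_fun_linear : linear add_fun.
Proof. by move=> a u v; rewrite /add_fun !linearP scalerDr addrACA. Qed.

HB.instance Definition _ :=
  GRing.isLinear.Build k 'rV[k]_(1 + 1) 'rV[k]_1 *:%R add_fun add_fun_linear.

Definition dup_fun (v : 'rV[k]_1) : 'rV[k]_(1 + 1) := row_mx v v.

Lemma dup_fun_linear : linear dup_fun.
Proof. by move=> a u v; rewrite /dup_fun scale_row_mx add_row_mx. Qed.

HB.instance Definition _ :=
  GRing.isLinear.Build k 'rV[k]_1 'rV[k]_(1 + 1) *:%R dup_fun dup_fun_linear.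

Definition FV_interp m n (x : FV_sig m n) : FinVect m n :=
  match x in FV_sig m n return 'Hom('rV[k]_m, 'rV[k]_n) with
  | Scal c => c *: \1%VF
  | Mu => linfun add_fun
  | Zeta => 0
  | Delta => linfun dup_fun
  | Bang => 0
  end.

Lemma FV_interp_ScalE c (x : 'rV[k]_1) : FV_interp (Scal c) x = c *: x.
Proof. by rewrite scale_lfunE id_lfunE. Qed.

Lemma FV_interp_MuE (x y : 'rV[k]_1) : FV_interp Mu (row_mx x y) = x + y.
Proof. by rewrite lfunE /= /add_fun row_mxKl row_mxKr. Qed.

Lemma FV_interp_DeltaE (x : 'rV[k]_1) : FV_interp Delta x = row_mx x x.
Proof. by rewrite lfunE. Qed.

Local Notation s c := (@TGen FV_sig 1%N 1%N (Scal c)).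
Local Notation μ := (@TGen FV_sig 2%N 1%N Mu).
Local Notation ζ := (@TGen FV_sig 0%N 1%N Zeta).
Local Notation Δ := (@TGen FV_sig 1%N 2%N Delta).
Local Notation "'!'" := (@TGen FV_sig 1%N 0%N Bang).
Local Notation "1" := (@TId1 FV_sig) : sterm_scope.
Local Notation "1_0" := (@TId0 FV_sig) : sterm_scope.
Local Notation B := (@TBraid FV_sig).

Local Open Scope sterm_scope.

Inductive FV_eqs : equations FV_sig :=
| FV_mu_unit : FV_eqs (μ ∘ (ζ ⊕ 1)) 1
| FV_mu_assoc : FV_eqs (μ ∘ (1 ⊕ μ)) (μ ∘ (μ ⊕ 1))
| FV_mu_comm : FV_eqs (μ ∘ B) μ
| FV_Delta_counit : FV_eqs ((! ⊕ 1) ∘ Δ) 1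
| FV_Delta_coassoc : FV_eqs ((1 ⊕ Δ) ∘ Δ) ((Δ ⊕ 1) ∘ Δ)
| FV_Delta_cocomm : FV_eqs (B ∘ Δ) Δ
| FV_Delta_mu : FV_eqs (Δ ∘ μ) ((μ ⊕ μ) ∘ ((1 ⊕ B ⊕ 1) ∘ (Δ ⊕ Δ)))
| FV_Delta_zeta : FV_eqs (Δ ∘ ζ) (ζ ⊕ ζ)
| FV_bang_mu : FV_eqs (! ∘ μ) (! ⊕ !)
| FV_bang_zeta : FV_eqs (! ∘ ζ) 1_0
| FV_scal_mul : forall b c, FV_eqs (s (b * c)%R) (s b ∘ s c)
| FV_scal_add : forall b c, FV_eqs (s (b + c)%R) (μ ∘ (s b ⊕ s c) ∘ Δ)
| FV_scal_one : FV_eqs (s 1%R) 1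
| FV_scal_zero : FV_eqs (s 0%R) (ζ ∘ !)
| FV_mu_scal : forall c, FV_eqs (μ ∘ (s c ⊕ s c)) (s c ∘ μ)
| FV_scal_zeta : forall c, FV_eqs (s c ∘ ζ) ζ
| FV_Delta_scal : forall c, FV_eqs ((s c ⊕ s c) ∘ Δ) (Δ ∘ s c)
| FV_bang_scal : forall c, FV_eqs (! ∘ s c) !.

End FinVect.

(* Main.v *)
Require Import Defs.
From mathcomp Require Import all_boot all_order all_algebra.
From mathcomp Require Import boolp zify.

(** The functor to FinVect is full, because every matrix is built from scalars,
sums and copies.  It remains to see that two terms with the same matrix are
equal in every PROP where the equations hold (a model).  In the absence of
subtraction this is a statement about biproducts.

In a model every object n has a copying map [dup n : n -> n + n] and a
discarding map [discard n : n -> 0], made of copies of the generators.  The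
generators commute with these maps: for mu, zeta and the scalars this is the
content of the bimonoid equations and of the equations on Delta, ! and scalars,
and for Delta and ! it follows from the laws of a cocommutative comonoid.
Naturality of the braiding propagates this to all terms: every term is a
comonoid homomorphism ([comonoid_hom_ev]).  Hence n + p behaves as a product,
and a term m -> n is determined by its n components m -> 1 ([ev_pairing]).

Each component is a linear form x |-> a_1 x_1 + ... + a_m x_m, written as a
standard term [form a].  These forms are closed under addition and scaling
because mu is commutative, associative and compatible with the scalars, which
add and multiply as in k ([form_add], [form_scale]).  So composition of terms with known components
multiplies matrices, and a term t has [matrix_of t] as matrix of components in
every model ([has_matrix_of]).  In the model FinVect a linear map determines its
matrix, so equal linear maps come from terms with equal matrices, and such terms
agree in all models ([FV_faithful]).

A PROP morphism that is full and identifies only what every coequalizing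
morphism identifies is a coequalizer ([coequalizer_of_full]). *)

Set Implicit Arguments.
Unset Strict Implicit.
Unset Printing Implicit Defensive.

Import GRing.Theory.

(** * Arrows of a PROP with a strictly associative tensor product *)

(** The source and target are data of an arrow, so that strict associativity and
unitality of the tensor product are equalities without transport ([atensA],
[atens0r]).  The price is that composition must be total: [z] supplies a value
for arrows that do not compose. *)
Section Arrows.
Variables (P : PROP) (z : forall m n, P m n).
Let A := propP P.

Record arrow := Arrow { src : nat; tgt : nat; arr : P src tgt }.

Definition acomp (g f : arrow) : arrow :=
  Arrow (if tgt f =P src g is ReflectT e
         then (arr g ∘ hcast erefl e (arr f))%PR else z (src f) (tgt g)).
Definition atens (f g : arrow) : arrow := Arrow (arr f ⊕ arr g)%PR.
Definition aid n : arrow := Arrow (idm n : P n n).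
Definition abraid m n : arrow := Arrow (braid m n : P (m + n) (n + m)).

Lemma src_comp g f : src (acomp g f) = src f. Proof. by []. Qed.
Lemma tgt_comp g f : tgt (acomp g f) = tgt g. Proof. by []. Qed.
Lemma src_tens f g : src (atens f g) = src f + src g. Proof. by []. Qed.
Lemma tgt_tens f g : tgt (atens f g) = tgt f + tgt g. Proof. by []. Qed.
Definition endsE := (src_comp, tgt_comp, src_tens, tgt_tens).
(* Closes the side conditions, which compare sources and targets. *)
Local Ltac ends := rewrite ?endsE /=; lia.
Arguments acomp : simpl never.
Arguments atens : simpl never.
Local Notation "g ∙ f" := (acomp g f) (at level 40, left associativity).
Local Notation "f ⊗ g" := (atens f g) (at level 38, left associativity).
Local Notation I := aid.
Local Notation B := abraid.

Lemma Arrow_cast m m' n n' (em : m = m') (en : n = n') (f : P m n) :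
  Arrow (hcast em en f) = Arrow f.
Proof. by case: m' / em; case: n' / en. Qed.

(** Endpoints are natural numbers, so that the dependent pair can be inverted
without an axiom. *)
Lemma Arrow_inj m n (f g : P m n) : Arrow f = Arrow g -> f = g.
Proof.
move=> fg; pose c (a : arrow) (em : src a = m) (en : tgt a = n) :=
  hcast em en (arr a).
have E (a b : arrow) (ab : a = b) em en em' en' : c a em en = c b em' en'.
  by case: b / ab em' en' => em' en'; apply: hcast_irr.
exact: (E _ _ fg erefl erefl erefl erefl).
Qed.

Lemma Arrow_comp m n p (g : P n p) (f : P m n) :
  Arrow (g ∘ f)%PR = Arrow g ∙ Arrow f.
Proof.
rewrite /acomp /=; case: eqP => //= e.
by rewrite (hcast_id erefl e).
Qed.

Lemma acompA (h g f : arrow) : tgt f = src g -> tgt g = src h ->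
  h ∙ (g ∙ f) = h ∙ g ∙ f.
Proof.
case: f => m n f; case: g => n' p g; case: h => p' q h /= e1 e2.
case: n' / e1 g => g; case: p' / e2 h => h.
by rewrite -!Arrow_comp (ax_compA A).
Qed.

Lemma acompI f n : tgt f = n -> I n ∙ f = f.
Proof. by case: f => m n' f <- /=; rewrite -Arrow_comp (ax_comp1m A). Qed.

Lemma aIcomp f n : src f = n -> f ∙ I n = f.
Proof. by case: f => m n' f <- /=; rewrite -Arrow_comp (ax_compm1 A). Qed.

Lemma atensI m n : I m ⊗ I n = I (m + n).
Proof. by rewrite /atens /= (ax_tens_id A). Qed.

Lemma interchange g f g' f' : tgt f = src g -> tgt f' = src g' ->
  (g ∙ f) ⊗ (g' ∙ f') = (g ⊗ g') ∙ (f ⊗ f').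
Proof.
case: f => m n f; case: g => n1 p g; case: f' => m' n' f'; case: g' => n2 p' g'.
move=> /= e1 e2; case: n1 / e1 g => g; case: n2 / e2 g' => g'.
by rewrite -!Arrow_comp /= -(ax_tens_comp A).
Qed.

Lemma interchange3 h h' g g' f f' :
  tgt h' = src h -> tgt g' = src g -> tgt f' = src f ->
  (h ∙ h') ⊗ (g ∙ g') ⊗ (f ∙ f') = (h ⊗ g ⊗ f) ∙ (h' ⊗ g' ⊗ f').
Proof. by move=> eh eg ef; rewrite !interchange // /= eh eg. Qed.

Lemma atensA f g h : f ⊗ (g ⊗ h) = f ⊗ g ⊗ h.
Proof. by rewrite {3 4}/atens /= -(ax_tensA A) Arrow_cast. Qed.

Lemma atens0l f : I 0 ⊗ f = f.
Proof. by case: f => m n f; rewrite /atens /= (ax_tens0m A). Qed.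

Lemma atens0r f : f ⊗ I 0 = f.
Proof.
case: f => m n f; rewrite /atens /=.
by rewrite -[RHS](congr1 (@Arrow m n) (ax_tensm0 A f)) Arrow_cast.
Qed.

Lemma abraid_nat f g :
  B (tgt f) (tgt g) ∙ (f ⊗ g) = (g ⊗ f) ∙ B (src f) (src g).
Proof. by rewrite /atens /abraid -!Arrow_comp (ax_braid_nat A). Qed.

Lemma abraidK m n : B n m ∙ B m n = I (m + n).
Proof. by rewrite -Arrow_comp (ax_braidK A). Qed.

Lemma abraidr0 m : B m 0 = I m.
Proof. by rewrite /aid -(ax_braidm0 A m) Arrow_cast. Qed.

Lemma abraidl0 n : B 0 n = I n.
Proof. by rewrite /aid -(braid0m P n) Arrow_cast. Qed.

Lemma abraidDr m n p : B m (n + p) = (I n ⊗ B m p) ∙ (B m n ⊗ I p).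
Proof.
rewrite -[LHS](Arrow_cast (addnA m n p) erefl) (ax_hexagon A m n p).
by rewrite Arrow_comp Arrow_cast.
Qed.

Lemma whiskl n g f : tgt f = src g -> I n ⊗ (g ∙ f) = (I n ⊗ g) ∙ (I n ⊗ f).
Proof. by move=> e; rewrite -interchange // acompI. Qed.

Lemma whiskr n g f : tgt f = src g -> (g ∙ f) ⊗ I n = (g ⊗ I n) ∙ (f ⊗ I n).
Proof. by move=> e; rewrite -interchange // acompI. Qed.

Lemma tens_compl g f h : tgt f = src g ->
  (g ∙ f) ⊗ h = (g ⊗ I (tgt h)) ∙ (f ⊗ h).
Proof. by move=> e; rewrite -interchange // acompI. Qed.

Lemma tens_compr g f h : tgt f = src g ->
  h ⊗ (g ∙ f) = (I (tgt h) ⊗ g) ∙ (h ⊗ f).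
Proof. by move=> e; rewrite -interchange // acompI. Qed.

Lemma tens_lr f g m n : src f = m -> tgt g = n ->
  (f ⊗ I n) ∙ (I m ⊗ g) = f ⊗ g.
Proof. by move=> <- <-; rewrite -interchange // aIcomp // acompI. Qed.

Lemma tens_rl f g m n : src g = m -> tgt f = n ->
  (I n ⊗ g) ∙ (f ⊗ I m) = f ⊗ g.
Proof. by move=> <- <-; rewrite -interchange // aIcomp // acompI. Qed.

(** The second hexagon: its right side has the same inverse as its left side, by
the first hexagon. *)
Lemma abraidDl m n p : B (m + n) p = (B m p ⊗ I n) ∙ (I m ⊗ B n p).
Proof.
have K : B p (m + n) ∙ ((B m p ⊗ I n) ∙ (I m ⊗ B n p)) = I (m + n + p).
  rewrite abraidDr acompA; try ends.
  rewrite -(acompA (f := B m p ⊗ I n)); try ends.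
  rewrite -whiskr //= abraidK atensI aIcomp; try ends.
  by rewrite -whiskl //= abraidK atensI addnA.
have := congr1 (acomp (B (m + n) p)) K.
by rewrite aIcomp //= acompA; try ends; rewrite abraidK acompI; try ends.
Qed.

End Arrows.

(** * Standard terms *)

Section Terms.
Local Open Scope ring_scope.
Variable k : fieldType.
Local Notation T := (term (FV_sig k)).
Local Notation s c := (@TGen (FV_sig k) 1%N 1%N (Scal c)).
Local Notation μ := (@TGen (FV_sig k) 2%N 1%N (Mu k)).
Local Notation ζ := (@TGen (FV_sig k) 0%N 1%N (Zeta k)).
Local Notation Δ := (@TGen (FV_sig k) 1%N 2%N (Delta k)).
Local Notation "'!'" := (@TGen (FV_sig k) 1%N 0%N (Bang k)).

Lemma dup_type n : (1 + (n + 1) + n = 1 + n + (1 + n))%N.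
Proof. lia. Qed.

(** In FinVect this is v |-> (v, v): the braiding moves the second copy of the
first coordinate past the first copy of the other ones. *)
Fixpoint dup n : T n (n + n) :=
  if n is n'.+1 then
    hcast erefl (dup_type n')
      (((TId1 ⊕ term_braid1 (FV_sig k) n') ⊕ term_id _ n') ∘ (Δ ⊕ dup n'))%ST
  else TId0.

Fixpoint discard n : T n 0 := if n is n'.+1 then TTens ! (discard n') else TId0.

Fixpoint zeros n : T 0 n := if n is n'.+1 then TTens ζ (zeros n') else TId0.

Definition drop_first n : T (1 + n) n := (! ⊕ term_id _ n)%ST.

(** The linear form v |-> v *m a. *)
Fixpoint form m : 'cV[k]_m -> T m 1 :=
  if m is m'.+1 return 'cV[k]_m -> T m 1 then fun a : 'cV[k]_(1 + m') =>
    (μ ∘ (s (usubmx a ord0 ord0) ⊕ form (dsubmx a)))%ST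
  else fun=> ζ.

Fixpoint term_of_matrix m n : 'M[k]_(m, n) -> T m n :=
  if n is n'.+1 return 'M[k]_(m, n) -> T m n then fun A : 'M[k]_(m, 1 + n') =>
    ((form (lsubmx A) ⊕ term_of_matrix (rsubmx A)) ∘ dup m)%ST
  else fun=> discard m.

Definition gen_matrix m n (x : FV_sig k m n) : 'M[k]_(m, n) :=
  match x in FV_sig _ m n return 'M[k]_(m, n) with
  | Scal c => c%:M
  | Mu => col_mx 1%:M 1%:M : 'M_(1 + 1, 1)
  | Zeta => 0
  | Delta => row_mx 1%:M 1%:M : 'M_(1, 1 + 1)
  | Bang => 0
  end.

(** Matrices act on row vectors from the right, which reverses the order of the
factors of a composite. *)
Fixpoint matrix_of m n (t : T m n) : 'M[k]_(m, n) :=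
  match t in term _ m n return 'M[k]_(m, n) with
  | TId0 => 1%:M
  | TId1 => 1%:M
  | TBraid => block_mx 0 1%:M 1%:M 0 : 'M_(1 + 1, 1 + 1)
  | TGen _ _ x => gen_matrix x
  | TComp _ _ _ g f => matrix_of f *m matrix_of g
  | TTens _ _ _ _ f g => block_mx (matrix_of f) 0 0 (matrix_of g)
  end.
End Terms.

Lemma lsubmx_col_mx (R : Type) m p n1 n2 (A : 'M[R]_(m, n1 + n2))
  (C : 'M[R]_(p, n1 + n2)) : lsubmx (col_mx A C) = col_mx (lsubmx A) (lsubmx C).
Proof.
by apply/matrixP => i j; rewrite !mxE; case: split => u; rewrite !mxE.
Qed.

Lemma rsubmx_col_mx (R : Type) m p n1 n2 (A : 'M[R]_(m, n1 + n2))
  (C : 'M[R]_(p, n1 + n2)) : rsubmx (col_mx A C) = col_mx (rsubmx A) (rsubmx C).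
Proof.
by apply/matrixP => i j; rewrite !mxE; case: split => u; rewrite !mxE.
Qed.

(** * Terms are comonoid homomorphisms in every model *)

Section Model.
Local Open Scope ring_scope.
Variables (k : fieldType) (P : PROP) (phi : forall m n, FV_sig k m n -> P m n).
Hypothesis phiE :
  forall m n (t u : term _ m n), FV_eqs t u -> eval phi t = eval phi u.

(* The zero map serves as the value of composites of non-composable arrows. *)
Let z m n : P m n := (eval phi (zeros k n) ∘ eval phi (discard k m))%PR.
Let arrow := arrow P.
Local Notation "g ∙ f" := (acomp z g f) (at level 40, left associativity).
Local Notation "f ⊗ g" := (atens f g) (at level 38, left associativity).
Local Notation I n := (aid P n%N).
Local Notation B m n := (abraid P m%N n%N).

Definition ev m n (t : term (FV_sig k) m n) : arrow := Arrow (eval phi t).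

Local Notation s c := (ev (@TGen (FV_sig k) 1%N 1%N (Scal c))).
Local Notation μ := (ev (@TGen (FV_sig k) 2%N 1%N (Mu k))).
Local Notation ζ := (ev (@TGen (FV_sig k) 0%N 1%N (Zeta k))).
Local Notation Δ := (ev (@TGen (FV_sig k) 1%N 2%N (Delta k))).
Local Notation "'!'" := (ev (@TGen (FV_sig k) 1%N 0%N (Bang k))).
Local Notation D n := (ev (dup k n%N)).
Local Notation E n := (ev (discard k n%N)).
Local Notation F a := (ev (form a)).

Lemma ev_comp m n p (g : term _ n p) (f : term _ m n) :
  ev (TComp g f) = ev g ∙ ev f.
Proof. exact: Arrow_comp. Qed.

Lemma ev_tens m n p q (f : term _ m n) (g : term _ p q) :
  ev (TTens f g) = ev f ⊗ ev g.
Proof. by []. Qed.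

Lemma ev_cast m m' n n' (em : m = m') (en : n = n') (t : term _ m n) :
  ev (hcast em en t) = ev t.
Proof. by case: m' / em; case: n' / en. Qed.

Lemma ev_id0 : ev TId0 = I 0. Proof. by []. Qed.
Lemma ev_id1 : ev TId1 = I 1. Proof. by []. Qed.
Lemma ev_braid11 : ev TBraid = B 1 1. Proof. by []. Qed.
Lemma ev_id n : ev (term_id _ n) = I n. Proof. by rewrite /ev eval_id. Qed.
Lemma ev_braid1 n : ev (term_braid1 _ n) = B 1 n.
Proof. by rewrite /ev eval_braid1. Qed.

Lemma ev_eq m n (t u : term _ m n) : FV_eqs t u -> ev t = ev u.
Proof. by move=> /phiE tu; rewrite /ev tu. Qed.

Definition evE :=
  (ev_comp, ev_tens, ev_id0, ev_id1, ev_braid11, ev_id, ev_braid1, ev_cast).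

Lemma src_ev m n (t : term _ m n) : src (ev t) = m. Proof. by []. Qed.
Lemma tgt_ev m n (t : term _ m n) : tgt (ev t) = n. Proof. by []. Qed.

Ltac ends := rewrite ?endsE ?src_ev ?tgt_ev /=; solve [done | lia].

Lemma dupS n : D (1 + n) = (I 1 ⊗ B 1 n ⊗ I n) ∙ (Δ ⊗ D n).
Proof. by rewrite [dup k (1 + n)]/= !evE. Qed.

Lemma discardS n : E (1 + n) = ! ⊗ E n. Proof. by []. Qed.

Ltac law e := have := ev_eq e; rewrite !evE.
Lemma mu_unitl : μ ∙ (ζ ⊗ I 1) = I 1. Proof. by law (FV_mu_unit k). Qed.
Lemma mu_assoc : μ ∙ (I 1 ⊗ μ) = μ ∙ (μ ⊗ I 1).
Proof. by law (FV_mu_assoc k). Qed.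
Lemma mu_comm : μ ∙ B 1 1 = μ. Proof. by law (FV_mu_comm k). Qed.
Lemma delta_counitl : (! ⊗ I 1) ∙ Δ = I 1.
Proof. by law (FV_Delta_counit k). Qed.
Lemma delta_coassoc : (I 1 ⊗ Δ) ∙ Δ = (Δ ⊗ I 1) ∙ Δ.
Proof. by law (FV_Delta_coassoc k). Qed.
Lemma delta_cocomm : B 1 1 ∙ Δ = Δ. Proof. by law (FV_Delta_cocomm k). Qed.
Lemma delta_mu : Δ ∙ μ = (μ ⊗ μ) ∙ ((I 1 ⊗ B 1 1 ⊗ I 1) ∙ (Δ ⊗ Δ)).
Proof. by law (FV_Delta_mu k). Qed.
Lemma delta_zeta : Δ ∙ ζ = ζ ⊗ ζ. Proof. by law (FV_Delta_zeta k). Qed.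
Lemma bang_mu : ! ∙ μ = ! ⊗ !. Proof. by law (FV_bang_mu k). Qed.
Lemma bang_zeta : ! ∙ ζ = I 0. Proof. by law (FV_bang_zeta k). Qed.
Lemma scal_mul b c : s (b * c) = s b ∙ s c.
Proof. by law (FV_scal_mul b c). Qed.
Lemma scal_add b c : s (b + c) = μ ∙ (s b ⊗ s c) ∙ Δ.
Proof. by law (FV_scal_add b c). Qed.
Lemma scal_one : s 1 = I 1. Proof. by law (FV_scal_one k). Qed.
Lemma scal_zero : s 0 = ζ ∙ !. Proof. by law (FV_scal_zero k). Qed.
Lemma mu_scal c : μ ∙ (s c ⊗ s c) = s c ∙ μ. Proof. by law (FV_mu_scal c). Qed.
Lemma scal_zeta c : s c ∙ ζ = ζ. Proof. by law (FV_scal_zeta c). Qed.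
Lemma delta_scal c : (s c ⊗ s c) ∙ Δ = Δ ∙ s c.
Proof. by law (FV_Delta_scal c). Qed.
Lemma bang_scal c : ! ∙ s c = !. Proof. by law (FV_bang_scal c). Qed.

Lemma discardD m n : E (m + n) = E m ⊗ E n.
Proof.
elim: m => [|m IHm]; first by rewrite atens0l.
by rewrite (discardS (m + n)) IHm discardS atensA.
Qed.

(** Induction on m; by the hexagons, both sides of the step move the m + n
coordinates past the copy of the new one and past each other in the same way. *)
Lemma dupD m n : D (m + n) = (I m ⊗ B m n ⊗ I n) ∙ (D m ⊗ D n).
Proof.
elim: m => [|m IHm].
  by rewrite !atens0l abraidl0 atensI acompI.
rewrite (dupS (m + n)) dupS IHm.
rewrite tens_compr; try ends; rewrite tens_compl; try ends.
rewrite -[Δ ⊗ D m ⊗ D n]atensA.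
rewrite !acompA; try ends; congr (_ ∙ _).
(* What remains after removing the outermost identities: moving one strand past
   m + n and m strands past n, in either order. *)
have core : (B 1 (m + n) ⊗ I m) ∙ (I (1 + m) ⊗ B m n) =
    (I m ⊗ B (1 + m) n) ∙ (B 1 m ⊗ I (m + n)).
  rewrite (abraidDr z) (abraidDl z) whiskr; try ends; rewrite whiskl; try ends.
  rewrite -!acompA; try ends; rewrite !atensA; congr (_ ∙ _).
  rewrite -[_ ⊗ I n ⊗ I m]atensA !atensI tens_lr; try ends.
  by rewrite tens_rl; try ends.
transitivity (I 1 ⊗ ((B 1 (m + n) ⊗ I m) ∙ (I (1 + m) ⊗ B m n)) ⊗ I n).
  rewrite whiskl; try ends; rewrite whiskr; try ends.
  by rewrite !atensA !atensI -!atensA !atensI.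
rewrite core whiskl; try ends; rewrite whiskr; try ends.
by rewrite !atensA !atensI -!atensA !atensI !atensA tgt_ev addnA.
Qed.

Definition comonoid_hom (f : arrow) : Prop :=
  D (tgt f) ∙ f = (f ⊗ f) ∙ D (src f) /\ E (tgt f) ∙ f = E (src f).

Lemma comonoid_hom_id n : comonoid_hom (I n).
Proof. by split; rewrite ?atensI ?acompI ?aIcomp; try ends. Qed.

Lemma comonoid_hom_comp g f : tgt f = src g ->
  comonoid_hom g -> comonoid_hom f -> comonoid_hom (g ∙ f).
Proof.
move=> e [Dg Eg] [Df Ef]; split; rewrite ?endsE.
  rewrite acompA // Dg -acompA; try ends; rewrite -e Df.
  by rewrite acompA; try ends; rewrite -interchange.
by rewrite acompA // Eg -e Ef.
Qed.

(** The middle exchange in [dupD] is natural. *)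
Lemma comonoid_hom_tens f g :
  comonoid_hom f -> comonoid_hom g -> comonoid_hom (f ⊗ g).
Proof.
move=> [Df Ef] [Dg Eg]; split; rewrite ?endsE; last first.
  by rewrite !discardD -interchange // Ef Eg.
rewrite !dupD -acompA; try ends; rewrite -interchange // Df Dg interchange //.
rewrite !acompA; try ends; congr (_ ∙ _).
have -> : f ⊗ f ⊗ (g ⊗ g) = f ⊗ (f ⊗ g) ⊗ g by rewrite !atensA.
have -> : f ⊗ g ⊗ (f ⊗ g) = f ⊗ (g ⊗ f) ⊗ g by rewrite !atensA.
by rewrite -!interchange3 // !acompI // !aIcomp // abraid_nat.
Qed.

(** By naturality the two doubled blocks are exchanged at once; the hexagons
write this as four exchanges, one of which cancels the middle exchange of
[dupD]. *)
Lemma comonoid_hom_braid m n : comonoid_hom (B m n).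
Proof.
split; rewrite /=; last first.
  by rewrite !discardD -(abraid_nat z (E m) (E n)) abraidl0 acompI.
rewrite !dupD -acompA; try ends.
rewrite -(abraid_nat z (D m) (D n)) !acompA; try ends; congr (_ ∙ _).
rewrite !tgt_ev.
rewrite (abraidDl z) !(abraidDr z m) whiskr; try ends.
rewrite whiskl; try ends; rewrite !acompA; try ends.
rewrite -[I n ⊗ B n m ⊗ I m ∙ _]whiskr; try ends.
rewrite -whiskl; try ends; rewrite abraidK !atensI.
rewrite acompI; last by ends.
rewrite !atensA; congr (_ ∙ _).
by rewrite -[_ ⊗ I n ⊗ I m]atensA !atensI tens_lr; try ends.
Qed.

Lemma dup1 : D 1 = Δ.
Proof. by rewrite (dupS 0) abraidr0 !atensI !atens0r acompI. Qed.

Lemma discard1 : E 1 = !.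
Proof. by rewrite (discardS 0) atens0r. Qed.

(** Follows from the left counit law by cocommutativity. *)
Lemma delta_counitr : (I 1 ⊗ !) ∙ Δ = I 1.
Proof.
rewrite -[RHS]delta_counitl -{1}delta_cocomm acompA; try ends.
by rewrite -(abraid_nat z ! (I 1)) abraidl0 acompI; try ends.
Qed.

Lemma comonoid_hom_scal c : comonoid_hom (s c).
Proof. by split; rewrite /= ?dup1 ?discard1 ?delta_scal ?bang_scal. Qed.

Lemma comonoid_hom_mu : comonoid_hom μ.
Proof.
split; rewrite /= ?dup1 ?discard1.
  by rewrite delta_mu (dupD 1 1) dup1.
by rewrite bang_mu (discardD 1 1) discard1.
Qed.

Lemma comonoid_hom_zeta : comonoid_hom ζ.
Proof.
split; rewrite /= ?dup1 ?discard1 ?bang_zeta // delta_zeta.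
by rewrite aIcomp.
Qed.

(** ! = ! o (! + 1) o Delta = (! + !) o Delta by the counit law. *)
Lemma comonoid_hom_bang : comonoid_hom !.
Proof.
split; rewrite /= ?dup1 ?discard1; last by rewrite acompI.
rewrite acompI // -[LHS](aIcomp z (n := 1)) // -delta_counitl acompA; try ends.
by rewrite -{1}(atens0l !) tens_rl.
Qed.

(** Coassociativity brings the two middle outputs of the fourfold copy together,
where cocommutativity absorbs their exchange. *)
Lemma comonoid_hom_delta : comonoid_hom Δ.
Proof.
have e : (Δ ⊗ Δ) ∙ Δ = (I 1 ⊗ Δ ⊗ I 1) ∙ ((I 1 ⊗ Δ) ∙ Δ).
  rewrite -(tens_rl z (m := 1) (n := 2)) // -acompA // -delta_coassoc.
  rewrite -(atensI P 1 1) -atensA acompA // -whiskl // delta_coassoc.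
  by rewrite whiskl // -acompA // atensA -delta_coassoc.
split; rewrite /= ?dup1 ?discard1.
  rewrite (dupD 1 1) dup1 -acompA // e acompA //.
  by rewrite -interchange3 // delta_cocomm !acompI.
rewrite (discardD 1 1) discard1 -(tens_rl z (m := 1) (n := 0)) // -acompA //.
by rewrite delta_counitl atens0l aIcomp.
Qed.

Lemma comonoid_hom_ev m n (t : term _ m n) : comonoid_hom (ev t).
Proof.
elim: m n / t => [|||m n [c| | | |]|m n p g homg f homf|m n p q f homf g homg].
- exact: (comonoid_hom_id 0).
- exact: (comonoid_hom_id 1).
- exact: (comonoid_hom_braid 1 1).
- exact: comonoid_hom_scal.
- exact: comonoid_hom_mu.
- exact: comonoid_hom_zeta.
- exact: comonoid_hom_delta.
- exact: comonoid_hom_bang.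
- by rewrite ev_comp; apply: comonoid_hom_comp.
- by rewrite ev_tens; apply: comonoid_hom_tens.
Qed.

Lemma discard_ev m n (t : term _ m n) : E n ∙ ev t = E m.
Proof. by have [] := comonoid_hom_ev t. Qed.

Lemma dup_ev m n (t : term _ m n) : D n ∙ ev t = (ev t ⊗ ev t) ∙ D m.
Proof. by have [] := comonoid_hom_ev t. Qed.

Lemma counitl n : (E n ⊗ I n) ∙ D n = I n.
Proof.
elim: n => [|n IHn]; first by rewrite atens0l acompI.
rewrite dupS discardS -(atensI P 1 n) acompA; try ends.
have -> : ! ⊗ E n ⊗ (I 1 ⊗ I n) = ! ⊗ (E n ⊗ I 1) ⊗ I n by rewrite !atensA.
rewrite -interchange3; try ends.
rewrite -(abraid_nat z (I 1) (E n)) abraidr0 !acompI // aIcomp //.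
rewrite atensA -(atensA (! ⊗ I 1)) -interchange; try ends.
by rewrite IHn delta_counitl.
Qed.

Lemma counitr n : (I n ⊗ E n) ∙ D n = I n.
Proof.
elim: n => [|n IHn]; first by rewrite atens0l acompI.
rewrite dupS discardS -(atensI P 1 n) acompA; try ends.
have -> : I 1 ⊗ I n ⊗ (! ⊗ E n) = I 1 ⊗ (I n ⊗ !) ⊗ E n by rewrite !atensA.
rewrite -interchange3; try ends.
rewrite -(abraid_nat z ! (I n)) abraidl0 !acompI // aIcomp //.
rewrite atensA -(atensA (I 1 ⊗ !)) -interchange; try ends.
by rewrite IHn delta_counitr.
Qed.

(** The two projections of 1 + n are jointly the identity: in [dupS] the two
discarded factors are adjacent, so the braiding between them disappears. *)
Lemma pairing_id n : (I 1 ⊗ E n ⊗ (! ⊗ I n)) ∙ D (1 + n) = I (1 + n).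
Proof.
have -> : I 1 ⊗ E n ⊗ (! ⊗ I n) = I 1 ⊗ (E n ⊗ !) ⊗ I n by rewrite !atensA.
rewrite dupS acompA; try ends; rewrite -interchange3; try ends.
rewrite -(abraid_nat z ! (E n)) abraidl0 !acompI //.
rewrite atensA -(atensA (I 1 ⊗ !)) -interchange; try ends.
by rewrite counitl delta_counitr atensI.
Qed.

(** The uniqueness half of the universal property of the product 1 + n; it
applies to all terms since copying commutes with them. *)
Lemma ev_pairing m n (t : term _ m (1 + n)) :
  ev t = (((I 1 ⊗ E n) ∙ ev t) ⊗ ((! ⊗ I n) ∙ ev t)) ∙ D m.
Proof.
by rewrite interchange // -acompA // -dup_ev acompA // pairing_id acompI.
Qed.

(** ** Linear forms *)

Lemma form0 (a : 'cV[k]_0) : F a = ζ. Proof. by []. Qed.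

Lemma formS m (a : 'cV[k]_(1 + m)) :
  F a = μ ∙ (s (usubmx a ord0 ord0) ⊗ F (dsubmx a)).
Proof. exact: ev_comp. Qed.

Lemma mu_unitr : μ ∙ (I 1 ⊗ ζ) = I 1.
Proof.
rewrite -mu_comm -acompA; try ends.
by rewrite (abraid_nat z (I 1) ζ) abraidr0 acompA // mu_unitl acompI.
Qed.

Lemma form1 (a : 'cV[k]_1) : F a = s (a ord0 ord0).
Proof.
rewrite (@formS 0) form0 -[s _ ⊗ ζ](tens_rl z (m := 0) (n := 1)) // acompA //.
rewrite mu_unitr atens0r acompI // mxE.
by have -> : lshift 0 (ord0 : 'I_1) = ord0 by apply: val_inj.
Qed.

(** (x + y) + (x' + y') = (x + x') + (y + y'). *)
Lemma medial : μ ∙ (μ ⊗ μ) ∙ (I 1 ⊗ B 1 1 ⊗ I 1) = μ ∙ (μ ⊗ μ).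
Proof.
have e : μ ∙ (μ ⊗ μ) = μ ∙ (I 1 ⊗ μ) ∙ (I 1 ⊗ μ ⊗ I 1).
  rewrite -(tens_lr z (m := 2) (n := 1)) // acompA // -mu_assoc.
  rewrite -(atensI P 1 1) -(atensA (I 1) (I 1) μ) -!acompA //; congr (_ ∙ _).
  rewrite -whiskl // mu_assoc.
  by rewrite whiskl // atensA.
by rewrite e -acompA // -interchange3 // mu_comm !acompI.
Qed.

(** After distributing the copies, the medial law collects the two first terms
and the two remaining sums; the former add up by additivity of scalars. *)
Lemma form_add m (a b : 'cV[k]_m) : F (a + b) = μ ∙ (F a ⊗ F b) ∙ D m.
Proof.
elim: m a b => [|m IHm] a b.
  by rewrite !form0 aIcomp // -[ζ ⊗ ζ](tens_lr z (m := 0) (n := 1)) // acompA //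
    mu_unitl atens0l acompI.
move: a b; rewrite -[m.+1]/(1 + m)%N => a b; rewrite !formS.
set a0 := usubmx a _ _; set b0 := usubmx b _ _.
set c' := dsubmx (a + b); set a' := dsubmx a; set b' := dsubmx b.
have -> : c' = a' + b' by rewrite /c' linearD.
have -> : usubmx (a + b) ord0 ord0 = a0 + b0 by rewrite /a0 /b0 !mxE.
rewrite IHm scal_add.
rewrite !interchange // !acompA // -[in LHS]medial dupS !acompA //; try ends.
congr (_ ∙ _); rewrite -!acompA; try ends; congr (_ ∙ (_ ∙ _)).
have -> : s a0 ⊗ F a' ⊗ (s b0 ⊗ F b') = s a0 ⊗ (F a' ⊗ s b0) ⊗ F b'.
  by rewrite !atensA.
have -> : s a0 ⊗ s b0 ⊗ (F a' ⊗ F b') = s a0 ⊗ (s b0 ⊗ F a') ⊗ F b'.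
  by rewrite !atensA.
by rewrite -!interchange3 // (abraid_nat z (s b0) (F a')) !acompI // !aIcomp.
Qed.

Lemma form_scale m c (a : 'cV[k]_m) : F (c *: a) = s c ∙ F a.
Proof.
elim: m a => [|m IHm] a; first by rewrite !form0 scal_zeta.
move: a; rewrite -[m.+1]/(1 + m)%N => a; rewrite !formS.
have -> : dsubmx (c *: a) = c *: dsubmx a by rewrite linearZ.
have -> : usubmx (c *: a) ord0 ord0 = c * usubmx a ord0 ord0 by rewrite !mxE.
rewrite IHm.
by rewrite acompA // -mu_scal -acompA // -interchange // -scal_mul.
Qed.

Lemma form_zero m : F (0 : 'cV_m) = ζ ∙ E m.
Proof.
elim: m => [|m IHm]; first by rewrite form0 aIcomp.
rewrite -[m.+1]/(1 + m)%N formS.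
have -> : dsubmx (0 : 'cV[k]_(1 + m)) = 0 by rewrite linear0.
rewrite IHm !mxE scal_zero interchange //.
rewrite acompA // -(tens_lr z (m := 0) (n := 1)) // acompA //.
by rewrite mu_unitl atens0l acompI.
Qed.

Lemma form_col0 m p (a : 'cV[k]_m) : F (col_mx a (0 : 'cV_p)) = F a ⊗ E p.
Proof.
elim: m a => [|m IHm] a.
  have -> : col_mx a 0 = 0 :> 'cV[k]_(0 + p).
    apply/matrixP => i j; rewrite !mxE; case: splitP => [[]//|u _].
    by rewrite mxE.
  by rewrite form_zero form0 -(tens_lr z (m := 0) (n := 0)) // atens0l atens0r.
move: a; rewrite -[m.+1]/(1 + m)%N => a.
have -> : col_mx a 0 = col_mx (usubmx a) (col_mx (dsubmx a) 0)
    :> 'cV[k]_(1 + (m + p)).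
  rewrite [RHS](@col_mxA _ 1 m p _ (usubmx a) (dsubmx a)).
  by rewrite castmx_id vsubmxK.
rewrite (@formS (m + p)) col_mxKu col_mxKd IHm formS atensA.
by rewrite tens_compl // tgt_ev atens0r.
Qed.

Lemma form_0col m p (b : 'cV[k]_p) : F (col_mx (0 : 'cV_m) b) = E m ⊗ F b.
Proof.
elim: m => [|m IHm]; first by rewrite col_flat_mx atens0l.
have -> : col_mx (0 : 'cV_(1 + m)) b = col_mx (0 : 'cV_1) (col_mx (0 : 'cV_m) b)
    :> 'cV[k]_(1 + (m + p)).
  rewrite [RHS](@col_mxA _ 1 m p _ 0 0) castmx_id.
  by rewrite col_mx0.
rewrite (@formS (m + p)) col_mxKu col_mxKd IHm mxE scal_zero.
rewrite -[E m ⊗ F b](acompI z (n := 1)) // interchange // acompA // mu_unitl.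
by rewrite acompI // -[m.+1]/(1 + m)%N discardS atensA.
Qed.

(** ** Matrices of terms *)

Lemma ev_drop_first n : ev (drop_first k n) = ! ⊗ I n.
Proof. by rewrite -ev_id. Qed.

(** The components of the term are the forms of the columns of the matrix.  The
recursion follows the decomposition 1 + n' of the target. *)
Fixpoint has_matrix m n : term (FV_sig k) m n -> 'M[k]_(m, n) -> Prop :=
  if n is n'.+1 return term (FV_sig k) m n -> 'M[k]_(m, n) -> Prop
  then fun t (A : 'M[k]_(m, 1 + n')) =>
    (I 1 ⊗ E n') ∙ ev t = F (lsubmx A) /\
    has_matrix (TComp (drop_first k n') t) (rsubmx A)
  else fun _ _ => True.

(** Substituting the components of a term into a linear form: the form is a sum
of scaled coordinates, and the sum is taken by [form_add] after pairing. *)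
Lemma form_comp m n (t : term _ m n) A (b : 'cV[k]_n) :
  has_matrix t A -> F b ∙ ev t = F (A *m b).
Proof.
elim: n t A b => [|n IHn] t A b.
  move=> _; have -> : A *m b = 0 by apply/matrixP => i j; rewrite !mxE big_ord0.
  by rewrite [RHS]form_zero -(discard_ev t) form0 acompI.
move: t A b; rewrite -[n.+1]/(1 + n)%N => t A b [t0 t'].
have e : F (dsubmx b) ∙ ((! ⊗ I n) ∙ ev t) = F (rsubmx A *m dsubmx b).
  by rewrite -(IHn _ _ _ t') ev_comp ev_drop_first.
rewrite (ev_pairing t) t0 formS.
rewrite -acompA // [(_ ⊗ F _) ∙ _]acompA // -interchange // e -form_scale.
rewrite acompA // -form_add; congr (F _).
rewrite -[in RHS](hsubmxK A) -[in RHS](vsubmxK b) mul_row_col; congr (_ + _).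
by rewrite [usubmx b]mx11_scalar mul_mx_scalar mxE.
Qed.

Lemma has_matrix_ext m n (t u : term _ m n) A :
  ev t = ev u -> has_matrix t A -> has_matrix u A.
Proof.
elim: n t u A => [//|n IHn] t u A tu [t0 t']; split; first by rewrite -tu.
by apply: IHn t'; rewrite !ev_comp tu.
Qed.

(** A term is determined by its components, by repeated pairing. *)
Lemma has_matrix_inj m n (t u : term _ m n) A :
  has_matrix t A -> has_matrix u A -> ev t = ev u.
Proof.
elim: n t u A => [|n IHn] t u A.
  by move=> _ _; rewrite -[LHS](acompI z (n := 0)) // (discard_ev t)
    -(discard_ev u) acompI.
move=> [t0 t'] [u0 u']; rewrite (ev_pairing t) (ev_pairing u) t0 u0.
by have := IHn _ _ _ t' u'; rewrite !ev_comp ev_drop_first => ->.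
Qed.

Lemma has_matrix_comp m n p (t : term _ m n) (u : term _ n p) A C :
  has_matrix t A -> has_matrix u C -> has_matrix (TComp u t) (A *m C).
Proof.
move=> tA; elim: p u C => [//|p IHp] u C.
move: u C; rewrite -[p.+1]/(1 + p)%N => u C [u0 u']; split.
  rewrite ev_comp acompA // u0 (form_comp _ tA); congr (F _).
  by rewrite -[in RHS](hsubmxK C) mul_mx_row row_mxKl.
have -> : rsubmx (A *m C) = A *m rsubmx C.
  by rewrite -[in LHS](hsubmxK C) mul_mx_row row_mxKr.
by apply: has_matrix_ext (IHp _ _ u'); rewrite !ev_comp acompA.
Qed.

Lemma has_matrix1 m (t : term _ m 1) A : ev t = F A -> has_matrix t A.
Proof.
move=> tA; split=> //; rewrite atensI acompI // tA; congr (F _).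
by apply/matrixP => i j; rewrite mxE; congr (A _ _); apply: val_inj.
Qed.

Lemma has_matrix_discardl m p q (u : term _ p q) C :
  has_matrix u C -> has_matrix (TTens (discard k m) u) (col_mx 0 C).
Proof.
elim: q u C => [//|q IHq] u C.
move: u C; rewrite -[q.+1]/(1 + q)%N => u C [u0 u']; split.
  rewrite lsubmx_col_mx linear0 form_0col -u0 (ev_tens (discard k m) u).
  by rewrite -{1}(atens0l (_ ⊗ _)) -interchange // acompI.
rewrite rsubmx_col_mx linear0; apply: has_matrix_ext (IHq _ _ u').
rewrite !ev_comp (ev_tens _ (TComp _ u)) (ev_tens (discard k m) u).
rewrite ev_comp !ev_drop_first.
by rewrite -[! ⊗ I q in RHS](atens0l) -interchange // acompI.
Qed.

Lemma has_matrix_tens m n p q (t : term _ m n) (u : term _ p q) A C :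
  has_matrix t A -> has_matrix u C -> has_matrix (TTens t u) (block_mx A 0 0 C).
Proof.
move=> tA uC; elim: n t A tA => [|n IHn] t A tA.
  have -> : block_mx A 0 0 C = col_mx 0 C :> 'M_(m + p, 0 + q).
    by rewrite /block_mx !row_thin_mx.
  apply: has_matrix_ext (has_matrix_discardl m uC).
  change (E m ⊗ ev u = ev t ⊗ ev u); by rewrite -(discard_ev t) acompI.
move: t A tA; rewrite -[n.+1]/(1 + n)%N => t A [t0 t'].
have e : block_mx A 0 0 C = row_mx (col_mx (lsubmx A) 0)
   (block_mx (rsubmx A) 0 0 C) :> 'M_(m + p, 1 + (n + q)).
  rewrite !block_mxEh [RHS](@row_mxA _ _ 1 n q) castmx_id.
  by rewrite -(block_mxEh (lsubmx A)) /block_mx hsubmxK row_mx0.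
split.
  rewrite e row_mxKl form_col0 -t0 (ev_tens t u) (discardD n q) atensA.
  by rewrite -interchange // discard_ev.
rewrite e row_mxKr; apply: has_matrix_ext (IHn _ _ t').
rewrite (ev_tens (TComp (drop_first k n) t) u) !ev_comp (ev_tens t u).
rewrite !ev_drop_first -atensI atensA.
by rewrite -interchange // acompI.
Qed.

Lemma form_one : F (1%:M : 'M_1) = I 1.
Proof. by rewrite form1 mxE scal_one. Qed.

Lemma has_matrix2 m (t : term _ m 2) (a b : 'cV[k]_m) :
  (I 1 ⊗ !) ∙ ev t = F a -> (! ⊗ I 1) ∙ ev t = F b ->
  has_matrix t (row_mx a b : 'M_(m, 1 + 1)).
Proof.
move=> ta tb; split; first by rewrite discard1 row_mxKl.
by rewrite row_mxKr; apply: has_matrix1; rewrite ev_comp ev_drop_first.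
Qed.

Lemma has_matrix_gen m n (x : FV_sig k m n) :
  has_matrix (TGen x) (gen_matrix x).
Proof.
case: m n / x => [c||||]; last by [].
- by apply: has_matrix1; rewrite form1 mxE.
- apply: has_matrix1; rewrite /=.
  have -> : col_mx 1%:M 1%:M = col_mx 1%:M 0 + col_mx 0 1%:M :> 'cV[k]_(1 + 1).
    by rewrite add_col_mx addr0 add0r.
  rewrite form_add (form_col0 1 (1%:M : 'cV_1)) (form_0col 1 (1%:M : 'cV_1)).
  rewrite form_one -acompA //.
  by have := pairing_id 1; rewrite -discard1 => ->; rewrite aIcomp.
- by apply: has_matrix1; rewrite form0.
- by apply: has_matrix2; rewrite form_one (delta_counitl, delta_counitr).
Qed.

Lemma has_matrix_of m n (t : term (FV_sig k) m n) : has_matrix t (matrix_of t).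
Proof.
elim: m n / t => //= [||m n x|m n p g ling f linf|m n p q f linf g ling].
- by apply: has_matrix1; rewrite form_one.
- rewrite block_mxEh; apply: has_matrix2; rewrite ev_braid11.
    rewrite (form_0col 1 (1%:M : 'cV_1)) form_one discard1.
    by rewrite -(abraid_nat z ! (I 1)) abraidl0 acompI.
  rewrite (form_col0 1 (1%:M : 'cV_1)) form_one discard1.
  by rewrite -(abraid_nat z (I 1) !) abraidr0 acompI.
- exact: has_matrix_gen.
- exact: has_matrix_comp.
- exact: has_matrix_tens.
Qed.

Lemma has_matrix_term_of m n (A : 'M[k]_(m, n)) :
  has_matrix (term_of_matrix A) A.
Proof.
elim: n A => [//|n IHn] A; move: A; rewrite -[n.+1]/(1 + n)%N => A.
have e : ev (term_of_matrix A) =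
    (F (lsubmx A) ⊗ ev (term_of_matrix (rsubmx A))) ∙ D m.
  exact: ev_comp.
split.
  rewrite e acompA // -interchange // discard_ev acompI //.
  rewrite -[F _ ⊗ E m](tens_lr z (m := m) (n := 0)) //.
  by rewrite -acompA // counitr atens0r aIcomp.
apply: has_matrix_ext (IHn _); rewrite ev_comp ev_drop_first e.
rewrite acompA // -interchange //.
rewrite -discard1 discard_ev acompI //.
rewrite -[E m ⊗ _](tens_rl z (m := m) (n := 0)) //.
by rewrite -acompA // counitl atens0l aIcomp.
Qed.

End Model.

(** * The model FinVect *)

Section FinVect.
Local Open Scope ring_scope.
Variable k : fieldType.
Local Notation V := (FinVect k).
Local Notation ev := (eval (P := V) (@FV_interp k)).

Lemma linfun_dupE (x : 'rV[k]_1) : linfun (@dup_fun k) x = row_mx x x.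
Proof. exact: FV_interp_DeltaE. Qed.

Lemma linfun_addE (x y : 'rV[k]_1) : linfun (@add_fun k) (row_mx x y) = x + y.
Proof. exact: FV_interp_MuE. Qed.

Lemma row_mx3 (x y w : 'rV[k]_1) :
  row_mx x (row_mx y w) = row_mx (row_mx x y) w :> 'rV_(1 + 1 + 1).
Proof. by rewrite [LHS]row_mxA castmx_id. Qed.

Lemma row_mx4 (x y w u : 'rV[k]_1) :
  row_mx (row_mx x (row_mx y w)) u = row_mx (row_mx x y) (row_mx w u)
  :> 'rV_(1 + 1 + (1 + 1)).
Proof. by rewrite row_mx3 [RHS](@row_mxA _ _ (1 + 1) 1 1) castmx_id. Qed.

Lemma FV_interpP m n (t u : term _ m n) : FV_eqs t u -> ev t = ev u.
Proof.
have Z n1 n2 (x : 'rV[k]_n1) : (0 : 'Hom('rV[k]_n1, 'rV[k]_n2)) x = 0.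
  by rewrite lfunE.
have S c (x : 'rV[k]_1) : (c *: \1%VF : 'Hom('rV[k]_1, 'rV[k]_1)) x = c *: x.
  exact: FV_interp_ScalE.
have one n1 (x : 'rV[k]_n1) : \1%VF x = x by exact: id_lfunE.
(* The dimensions of the sums are given explicitly because the equations
   display them in the evaluated form, as 2 and not as 1 + 1. *)
pose d := @dsumE k.
have E := (comp_lfunE, d 0%N 1%N 1%N 1%N, d 1%N 1%N 2%N 1%N,
  d 2%N 1%N 1%N 1%N, d 1%N 0%N 1%N 1%N, d 1%N 1%N 1%N 2%N, d 1%N 2%N 1%N 1%N,
  d 2%N 1%N 2%N 1%N, d 1%N 1%N 2%N 2%N, d 3%N 3%N 1%N 1%N, d 1%N 2%N 1%N 2%N,
  d 0%N 1%N 0%N 1%N, d 1%N 0%N 1%N 0%N, d 1%N 1%N 1%N 1%N, @swapE k 1%N 1%N,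
  linfun_addE, linfun_dupE, one, Z, S).
case: m n t u /; move=> *; apply/lfunP => v /=.
- by rewrite -[v](@hsubmxK _ 1%N 0%N 1%N) !E add0r row0_mx.
- rewrite -[v](hsubmxK (v : 'rV_(1 + (1 + 1)))) -[rsubmx _]hsubmxK.
  rewrite !E row_mx3 !E.
  exact: addrA.
- by rewrite -[v](hsubmxK (v : 'rV_(1 + 1))) !E addrC.
- by rewrite !E row0_mx.
- by rewrite !E row_mx3.
- by rewrite !E.
- rewrite -[v](hsubmxK (v : 'rV_(1 + 1))) !E.
  set x := lsubmx _; set y := rsubmx _.
  by rewrite -row_mx4 !E row_mx4 !E.
- by rewrite -[v](@hsubmxK _ 1%N 0%N 0%N) !E.
- by rewrite -[v](@hsubmxK _ 1%N 1%N 1%N) !E row0_mx.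
- by rewrite !E; apply: rV0_eq.
- by rewrite !E scalerA.
- by rewrite !E scalerDl.
- by rewrite !E scale1r.
- by rewrite !E scale0r.
- by rewrite -[v](@hsubmxK _ 1%N 1%N 1%N) !E scalerDr.
- by rewrite !E scaler0.
- by rewrite !E.
- by rewrite !E.
Qed.

Lemma FV_eval_matrix m n (t : term (FV_sig k) m n) v :
  ev t v = v *m matrix_of t.
Proof.
elim: m n / t v => /= [v|v|v|m n x v|m n p g IHg f IHf v|m n p q f IHf g IHg v].
- by rewrite id_lfunE mulmx1.
- by rewrite id_lfunE mulmx1.
- rewrite -[v](@hsubmxK _ 1%N 1%N 1%N) (@swapE k 1%N 1%N).
  rewrite (@mul_row_block _ 1%N 1%N 1%N 1%N 1%N).
  by rewrite !mulmx0 !mulmx1 add0r addr0.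
- case: m n / x v => [c||||] v /=.
  + by rewrite mul_mx_scalar FV_interp_ScalE.
  + rewrite -[v](@hsubmxK _ 1%N 1%N 1%N) linfun_addE.
    by rewrite (@mul_row_col _ 1%N 1%N 1%N) !mulmx1.
  + by rewrite lfunE mulmx0.
  + by rewrite linfun_dupE (@mul_mx_row _ 1%N 1%N 1%N 1%N) mulmx1.
  + exact: rV0_eq.
- by rewrite comp_lfunE IHf IHg mulmxA.
- rewrite -[v]hsubmxK dsumE IHf IHg mul_row_block.
  by rewrite !mulmx0 add0r addr0.
Qed.

Lemma FV_eval_inj m n (t u : term (FV_sig k) m n) :
  ev t = ev u -> matrix_of t = matrix_of u.
Proof.
move=> tu; apply/row_matrixP => i.
by rewrite !rowE -!FV_eval_matrix tu.
Qed.

Lemma matrix_of_form m (a : 'cV[k]_m) : matrix_of (form a) = a.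
Proof.
elim: m a => [|m IHm] a; first by apply/matrixP => -[].
move: a; rewrite -[m.+1]/(1 + m)%N => a.
have -> : matrix_of (form a) =
    block_mx (usubmx a ord0 ord0)%:M 0 0 (matrix_of (form (dsubmx a))) *m
    (col_mx 1%:M 1%:M : 'M_(1 + 1, 1)) by [].
by rewrite IHm mul_block_col !mul0mx !mulmx1 addr0 add0r -mx11_scalar vsubmxK.
Qed.

(** In FinVect the columns can be recovered from the forms, as [form a] is the
multiplication by a. *)
Lemma FV_has_matrix_uniq m n (t : term (FV_sig k) m n) A C :
  has_matrix (@FV_interp k) t A -> has_matrix (@FV_interp k) t C -> A = C.
Proof.
elim: n t A C => [|n IHn] t A C; first by rewrite (thinmx0 A) (thinmx0 C).
move: t A C; rewrite -[n.+1]/(1 + n)%N => t A C [A0 A'] [C0 C'].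
rewrite -[A]hsubmxK -[C]hsubmxK (IHn _ _ _ A' C'); congr row_mx.
have /(@Arrow_inj V)/FV_eval_inj := etrans (esym A0) C0.
by rewrite !matrix_of_form.
Qed.

Lemma matrix_of_term_of m n (A : 'M[k]_(m, n)) :
  matrix_of (term_of_matrix A) = A.
Proof.
exact: FV_has_matrix_uniq (has_matrix_of FV_interpP (term_of_matrix A))
  (has_matrix_term_of FV_interpP A).
Qed.

Lemma FV_full m n (f : V m n) : exists t, ev t = f.
Proof.
exists (term_of_matrix (lin1_mx f)); apply/lfunP => v.
by rewrite FV_eval_matrix matrix_of_term_of mul_rV_lin1.
Qed.

(** Both terms have the same matrix in FinVect, and [matrix_of] does not depend
on the model. *)
Lemma FV_faithful (P : PROP) (phi : forall m n, FV_sig k m n -> P m n) :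
  (forall m n (t u : term _ m n), FV_eqs t u -> eval phi t = eval phi u) ->
  forall m n (t u : term _ m n), ev t = ev u -> eval phi t = eval phi u.
Proof.
move=> phiE m n t u /FV_eval_inj tu; apply: Arrow_inj.
apply: (has_matrix_inj phiE (has_matrix_of phiE t)).
by rewrite tu; apply: has_matrix_of.
Qed.
End FinVect.

(** * Coequalizers of PROPs *)

Section Coequalizers.

(** The induced morphism sends c to the value of G at any preimage of c; that
this does not depend on the preimage gives existence, and surjectivity of q
gives uniqueness. *)
Lemma coequalizer_of_full (A C Q : PROP) (f g : PROP_mor A C)
    (q : PROP_mor C Q) :
  mor_compose q f = mor_compose q g ->
  (forall m n (c : Q m n), exists a, q m n a = c) ->
  (forall (P : PROP) (G : PROP_mor C P), mor_compose G f = mor_compose G g ->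
    forall m n (a b : C m n), q m n a = q m n b -> G m n a = G m n b) ->
  is_coequalizer f g q.
Proof.
move=> qfg full faithful; split=> // P G Gfg.
pose r m n (c : Q m n) : C m n := sval (cid (full m n c)).
have rK m n c : q m n (r m n c) = c by rewrite /r; case: cid.
have GE m n (a : C m n) c : q m n a = c -> G m n (r m n c) = G m n a.
  by move=> <-; apply: (faithful _ _ Gfg); rewrite rK.
have H1 n : G n n (r n n (idm n)) = idm n.
  by rewrite -(mor_id G); apply/GE/mor_id.
have H2 m n p (y : Q n p) (x : Q m n) :
    G m p (r m p (y ∘ x)%PR) = (G n p (r n p y) ∘ G m n (r m n x))%PR.
  by rewrite -mor_comp; apply: GE; rewrite mor_comp !rK.
have H3 m n p s (x : Q m n) (y : Q p s) :
    G _ _ (r _ _ (x ⊕ y)%PR) = (G m n (r m n x) ⊕ G p s (r p s y))%PR.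
  by rewrite -mor_tens; apply: GE; rewrite mor_tens !rK.
have H4 m n : G _ _ (r _ _ (braid m n)) = braid m n.
  by rewrite -(mor_braid G); apply/GE/mor_braid.
exists (MkPROPMor H1 H2 H3 H4); split.
  by apply: PROP_mor_ext => m n a; apply: GE.
move=> H HG; apply: PROP_mor_ext => m n c /=.
by rewrite -HG /= rK.
Qed.

Lemma coequalizes_eqs (S : signature) (E : equations S) (P : PROP)
    (G : PROP_mor (freePROP S) P) :
  mor_compose G (lhs_mor E) = mor_compose G (rhs_mor E) <->
  forall m n (t u : term S m n),
    E m n t u -> G m n (tclass t) = G m n (tclass u).
Proof.
split=> [GE m n t u tu | GE].
  pose e : eq_signature E m n := exist _ (t, u) tu.
  pose at_e (F : PROP_mor (freePROP _) P) := F m n (tclass (TGen e)).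
  have := congr1 at_e GE.
  by rewrite /at_e /= !free_ext_fun_class.
pose phi m n (e : eq_signature E m n) := G m n (tclass (sval e).1).
rewrite (@free_ext_unique _ _ phi (mor_compose G (lhs_mor E))).
  apply: esym; apply: free_ext_unique => m n e.
  by rewrite /= free_ext_fun_class /= /phi; apply/esym/GE/(svalP e).
by move=> m n e; rewrite /= free_ext_fun_class.
Qed.

Lemma free_morE (S : signature) (P : PROP) (G : PROP_mor (freePROP S) P) m n
    (t : term S m n) :
  G m n (tclass t) = eval (fun m n x => G m n (tclass (TGen x))) t.
Proof. by rewrite -free_extE -(free_ext_unique (F := G)). Qed.
End Coequalizers.

Theorem mainTheorem1 (k : fieldType) :
  presented_by (@FV_eqs k) (free_ext (P := FinVect k) (@FV_interp k)).
Proof.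
apply: coequalizer_of_full => [|m n f|P G /coequalizes_eqs GE m n a b].
- apply/coequalizes_eqs => m n t u tu; rewrite !free_extE; exact: FV_interpP.
- by have [t <-] := FV_full f; exists (tclass t); rewrite free_extE.
rewrite -[a]treprK -[b]treprK !free_extE !free_morE.
apply: FV_faithful => m' n' t u tu.
by rewrite -!free_morE; apply: GE.
Qed.
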